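(* In the supersample setting described in the context, assume the loss takes values in $[0,1]$. Then \[ \left|\mathrm{Err}\right| \leq\frac{1}{n}\sum_{i=1}^n\mathbb E_{U_i}\!\left[\mathbb{W}(P_{\Delta L_i|U_i},P_{\Delta L_i})\right]. \]
   Context: Let $\mathcal Z=\mathcal X\times\mathcal Y$ and let $\mu$ be a distribution on $\mathcal Z$. A (possibly randomized) learning algorithm $\mathcal A$ maps a training sample in $\mathcal Z^n$ to a hypothesis $W\in\mathcal W$, and $\ell:\mathcal W\times\mathcal Z\to[0,\infty)$ is a loss. For $S=(Z_1,\dots,Z_n)\sim\mu^{n}$ and $W\sim P_{W|S}$, let $L_\mu=\mathbb E_W\mathbb E_{Z'\sim\mu}[\ell(W,Z')]$ (with $Z'$ independent of $(S,W)$), $L_n=\mathbb E_{W,S}[\frac1n\sum_i\ell(W,Z_i)]$, $\mathrm{Err}=L_\mu-L_n$. Supersample: $\widetilde Z=(\widetilde Z_{i,j})_{i\in\{1,\dots,n\},j\in\{0,1\}}$ with i.i.d. entries of law $\mu$; $U=(U_1,\dots,U_n)$ uniform on $\{0,1\}^n$, independent of $\widetilde Z$; $W=\mathcal A(\widetilde Z_U)$ with $\widetilde Z_U=(\widetilde Z_{1,U_1},\dots,\widetilde Z_{n,U_n})$. Put $L_{i,j}=\ell(W,\widetilde Z_{i,j})$ and $\Delta L_i=L_{i,1}-L_{i,0}$. $\mathbb W(P,Q)=\inf_{\gamma\in\Gamma(P,Q)}\int|x-x'|\,d\gamma(x,x')$ is the order-one Wasserstein distance on $\mathbb R$ (with the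 metric $|x-x'|$), where $\Gamma(P,Q)$ is the set of couplings of $P$ and $Q$. *)

(* Defs.v *)
From HB Require Import structures.
From mathcomp Require Import all_boot all_order all_algebra.
From mathcomp Require Import all_classical all_reals all_analysis.
Set Implicit Arguments. Unset Strict Implicit. Unset Printing Implicit Defensive.
Import Order.TTheory GRing.Theory Num.Theory.
Local Open Scope classical_set_scope.
Local Open Scope ring_scope.

Section defs.
Context {R : realType}.

Definition preimg {dO dT} {O : measurableType dO} {T : measurableType dT}
  (X : O -> T) : set (set O) :=
  fun E => exists2 A, measurable A & E = X @^-1` A.

(* mutual independence of a finite family of sigma-algebras (product rule;
   sub-families are covered by choosing A i = setT) *)
Definition mutual_indep {dO} {O : measurableType dO} (P : probability O R)
  (I : finType) (F : I -> set (set O)) : Prop :=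
  forall A : I -> set O, (forall i, F i (A i)) ->
    P (\bigcap_(i in [set: I]) A i) = (\prod_(i : I) fine (P (A i)))%:E.

Definition law {dO} {O : measurableType dO} (P : probability O R)
  (X : O -> R) : set R -> \bar R := fun A => P (X @^-1` A).

Definition cond_law {dO dT} {O : measurableType dO} {T : measurableType dT}
  (P : probability O R) (X : O -> R) (Y : O -> T) (b : T) : set R -> \bar R :=
  fun A => (P (X @^-1` A `&` Y @^-1` [set b]) *
            ((fine (P (Y @^-1` [set b])))^-1)%:E)%E.

Definition wasserstein1 (p q : set R -> \bar R) : \bar R :=
  ereal_inf [set (\int[gam]_xy (`| xy.1 - xy.2 |)%:E)%E
            | gam in [set gam : probability (R * R)%type R |
                 forall A : set R, measurable A ->
                   gam (fst @^-1` A) = p A /\ gam (snd @^-1` A) = q A]].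

End defs.

Definition select_sample {dO dZ} {O : measurableType dO} {Z : measurableType dZ}
  (n : nat) (Zt : 'I_n -> bool -> O -> Z) (U : 'I_n -> O -> bool) :
  O -> n.-tuple Z := fun w => [tuple Zt i (U i w) w | i < n].

Definition supersample_data {dO dZ} {O : measurableType dO} {Z : measurableType dZ}
  (n : nat) (Zt : 'I_n -> bool -> O -> Z) (U : 'I_n -> O -> bool) :
  O -> n.-tuple ((Z * Z) * bool)%type :=
  fun w => [tuple ((Zt i false w, Zt i true w), U i w) | i < n].

Definition supersample_family {dO dZ} {O : measurableType dO} {Z : measurableType dZ}
  (n : nat) (Zt : 'I_n -> bool -> O -> Z) (U : 'I_n -> O -> bool) :
  'I_n * option bool -> set (set O) :=
  fun k => match k.2 with
           | Some j => preimg (Zt k.1 j)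
           | None => preimg (U k.1)
           end.

Definition DeltaL {dO dZ dW} {O : measurableType dO} {Z : measurableType dZ}
  {Wt : measurableType dW} {R : realType}
  (n : nat) (loss : Wt -> Z -> R) (W : O -> Wt) (Zt : 'I_n -> bool -> O -> Z)
  (i : 'I_n) : O -> R :=
  fun w => loss (W w) (Zt i true w) - loss (W w) (Zt i false w).

Definition gen_error {dO dZ dW} {O : measurableType dO} {Z : measurableType dZ}
  {Wt : measurableType dW} {R : realType}
  (P : probability O R) (mu : probability Z R) (n : nat) (loss : Wt -> Z -> R)
  (S : O -> n.-tuple Z) (W : O -> Wt) : \bar R :=
  ((\int[P]_w (\int[mu]_z (loss (W w) z)%:E)) -
   (\int[P]_w ((n%:R)^-1 * \sum_(i < n) loss (W w) (tnth (S w) i))%:E))%E.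

(* Main.v *)
Require Import Defs.
From HB Require Import structures.
From mathcomp Require Import all_boot all_order all_algebra.
From mathcomp Require Import all_classical all_reals all_analysis.
From mathcomp Require Import measurable_realfun ring lra.
Import Order.TTheory GRing.Theory Num.Theory.
Local Open Scope classical_set_scope.
Local Open Scope ring_scope.

(* Given U_i = b, the point Z_{i,b} is a training point and Z_{i,1-b} a fresh one,
   so E[Delta L_i | U_i = b] = +-(A - T_i) with sign - for b = 1, where A is the
   population risk and T_i = E[loss(W, S_i)].  By the easy half of
   Kantorovich duality, tested on a translate of the identity clamped to [-1, 1],
   W(P_{Delta L_i | U_i = b}, P_{Delta L_i}) >= |E[Delta L_i | U_i = b] - E[Delta L_i]|;
   averaging over b and using the triangle inequality gives at least |A - T_i|,
   and Err is the mean of the A - T_i. *)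

Set Implicit Arguments.
Unset Strict Implicit.

(** * Transfer of integrals between spaces, and measures determined by rectangles *)

Lemma integral_mrestr (R : realType) (d : measure_display) (T : measurableType d)
  (m : {measure set T -> \bar R}) (D : set T) (mD : measurable D) (f : T -> \bar R) :
  measurable_fun [set: T] f -> (forall t, 0 <= f t)%E ->
  (\int[mrestr m mD]_t f t = \int[m]_(t in D) f t)%E.
Proof.
move=> mf f0; rewrite -(setUv D).
rewrite ge0_integral_setU//; last 3 first.
- exact: measurableC.
- by rewrite setUv.
- by rewrite disj_set2E setICr.
rewrite [X in (_ + X)%E]null_set_integral ?adde0//.
- by apply: eq_measure_integral => A mA AD; rewrite /= /mrestr setIidl.
- exact: measurableC.
- exact: measurable_funTS.
- by rewrite /= /mrestr setICl measure0.
Qed.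

(** Each side is the integral of [f] against a measure on [T]: restrict [P] to [E] and push it along
    [X], and likewise for the primed data. The hypothesis says that these two image measures agree
    up to the factor [c]. *)
Lemma ge0_integral_transfer (R : realType) (d d' dT : measure_display)
  (O : measurableType d) (O' : measurableType d') (T : measurableType dT)
  (P : {measure set O -> \bar R}) (P' : {measure set O' -> \bar R})
  (E : set O) (E' : set O') (X : O -> T) (X' : O' -> T) (c : R)
  (f : T -> \bar R) :
  measurable E -> measurable E' ->
  measurable_fun [set: O] X -> measurable_fun [set: O'] X' -> 0 <= c ->
  (forall C, measurable C -> P (E `&` X @^-1` C) = c%:E * P' (E' `&` X' @^-1` C))%E ->
  measurable_fun [set: T] f -> (forall t, 0 <= f t)%E ->
  (\int[P]_(w in E) f (X w) = c%:E * \int[P']_(w in E') f (X' w))%E.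
Proof.
move=> mE mE' mX mX' c0 PP' mf f0.
rewrite -(integral_mrestr P mE) => [||t]; [|exact: measurableT_comp|exact: f0].
rewrite -(integral_mrestr P' mE') => [||t]; [|exact: measurableT_comp|exact: f0].
rewrite -(preimage_setT X) -(preimage_setT X').
rewrite -!ge0_integral_pushforward//; try by move=> *; exact: f0.
rewrite -[c]/(NngNum c0)%:num -ge0_integral_mscale//.
apply: eq_measure_integral => A mA _.
by rewrite /= /mscale /pushforward /mrestr/= setIC PP'// setIC.
Qed.

(** Measurable rectangles are stable under intersection, generate the product sigma-algebra and
    include the whole space, so a finite measure is determined by its values on them. *)
Lemma finite_measure_prod_unique (R : realType) (d1 d2 : measure_display)
  (T1 : measurableType d1) (T2 : measurableType d2)
  (m m' : {measure set (T1 * T2) -> \bar R}) :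
  (m setT < +oo)%E ->
  (forall A B, measurable A -> measurable B -> m (A `*` B) = m' (A `*` B)) ->
  forall C, measurable C -> m C = m' C.
Proof.
move=> moo mm' C mC.
apply: (measure_unique [set A `*` B | A in measurable & B in measurable] (fun=> setT)) => //.
- exact: measurable_prod_measurableType.
- move=> _ _ [A1 mA1 [B1 mB1 <-]] [A2 mA2 [B2 mB2 <-]].
  rewrite -setXI; exists (A1 `&` A2); first exact: measurableI.
  by exists (B1 `&` B2) => //; exact: measurableI.
- by move=> _; exists setT => //; exists setT => //; rewrite setXTT.
- by rewrite bigcup_const.
- by move=> _ [A mA [B mB <-]]; exact: mm'.
Qed.

Definition box (n : nat) (T : Type) (A : 'I_n -> set T) : set (n.-tuple T) :=
  [set t | forall i, A i (tnth t i)].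

Lemma finite_measure_tuple_unique (R : realType) (d : measure_display) (n : nat)
  (T : measurableType d) (m m' : {measure set (n.-tuple T) -> \bar R}) :
  (m setT < +oo)%E ->
  (forall A : 'I_n -> set T, (forall i, measurable (A i)) -> m (box A) = m' (box A)) ->
  forall C, measurable C -> m C = m' C.
Proof.
move=> moo mm' C mC.
apply: (measure_unique [set box A | A in [set A | forall i, measurable (A i)]]
  (fun=> setT)) => //.
- apply/seteqP; split.
    apply: smallest_sub; first exact: smallest_sigma_algebra.
    rewrite -bigcup_seq => _ [i _ [B mB <-]]; apply: sub_sigma_algebra.
    (* A cylinder over the coordinate [i] is a box whose other sides are full, so boxes generate the
       sigma-algebra of tuples. *)
    exists (fun k => if k == i then B else setT) => /=.
      by move=> k; case: ifP.
    apply/seteqP; split => t /=.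
      by move=> /(_ i); rewrite eqxx.
    by move=> [_ Bt] k; case: eqP => // ->.
  apply: smallest_sub; first exact: sigma_algebra_measurable.
  move=> _ [A mA <-].
  rewrite (_ : box A = \big[setI/setT]_i
    (fun t : n.-tuple T => tnth t i) @^-1` (A i)); last first.
    rewrite -bigcap_seq; apply/seteqP; split => t /=.
      by move=> At i _; exact: At.
    by move=> At i; apply: At => //=; rewrite mem_index_enum.
  apply: bigsetI_measurable => i _.
  by rewrite -[X in measurable X]setTI; exact: measurable_tnth.
- move=> _ _ [A mA <-] [B mB <-]; exists (fun i => A i `&` B i).
    by move=> i; exact: measurableI.
  apply/seteqP; split => t /=.
    by move=> AB; split => i; have [] := AB i.
  by move=> [At Bt] i; split.
- by move=> _; exists (fun=> setT) => //; apply/seteqP; split.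
- by rewrite bigcup_const.
- by move=> _ [A mA <-]; exact: mm'.
Qed.

(** For pairs, it suffices to compare the image measures on rectangles. The left one has mass at
    most 1, which supplies the finiteness that uniqueness asks for. *)
Lemma ge0_integral_transfer_prod (R : realType) (d d' d1 d2 : measure_display)
  (O : measurableType d) (O' : measurableType d')
  (T1 : measurableType d1) (T2 : measurableType d2)
  (P : probability O R) (P' : {measure set O' -> \bar R})
  (E : set O) (X : O -> T1 * T2) (X' : O' -> T1 * T2) (c : R)
  (f : T1 * T2 -> \bar R) :
  measurable E ->
  measurable_fun [set: O] X -> measurable_fun [set: O'] X' -> 0 <= c ->
  (forall A B, measurable A -> measurable B ->
    P (E `&` X @^-1` (A `*` B)) = c%:E * P' (X' @^-1` (A `*` B)))%E ->
  measurable_fun [set: T1 * T2] f -> (forall x, 0 <= f x)%E ->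
  (\int[P]_(w in E) f (X w) = c%:E * \int[P']_w f (X' w))%E.
Proof.
move=> mE mX mX' c0 PP' mf f0; apply: ge0_integral_transfer => //.
pose m : {measure set (T1 * T2) -> \bar R} := pushforward (mrestr P mE) X.
pose m' : {measure set (T1 * T2) -> \bar R} :=
  mscale (NngNum c0) (pushforward P' X').
move=> C mC; have : m mX C = m' mX' C; last first.
  by rewrite /m /m'/= /mscale/= /pushforward /mrestr/= setIC setTI.
apply: finite_measure_prod_unique mC => [|A B mA mB].
  rewrite /m/= /pushforward /mrestr; apply: (@le_lt_trans _ _ 1%E); last exact: ltry.
  by apply: probability_le1; rewrite preimage_setT setTI.
by rewrite /m /m'/= /mscale/= /pushforward /mrestr/= setIC PP'.
Qed.

(** * Bounded integrands and lower bounds on the Wasserstein distance *)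

Lemma adde_fin_eq (R : realType) (g : \bar R) (x y : R) :
  (g + x%:E = y%:E)%E -> g = (y - x)%:E.
Proof. by case: g => //= r [<-]; rewrite addrK. Qed.

Lemma bounded_integrable (R : realType) (d : measure_display) (T : measurableType d)
  (P : probability T R) (D : set T) (f : T -> R) (M : R) :
  measurable D -> measurable_fun [set: T] f -> (forall t, 0 <= f t <= M) ->
  P.-integrable D (EFin \o f).
Proof.
move=> mD mf f0M; apply: measurable_bounded_integrable => //.
- by apply: le_lt_trans (probability_le1 _ _) _ => //; exact: ltry.
- exact: measurable_funTS.
- exists M; split; first exact: num_real.
  move=> x Mx t _ /=; have /andP[f0 fM] := f0M t.
  by rewrite ger0_norm// (le_trans fM)// ltW.
Qed.

Lemma bounded_integral_fin_num (R : realType) (d : measure_display) (T : measurableType d)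
  (P : probability T R) (D : set T) (f : T -> R) (M : R) :
  measurable D -> measurable_fun [set: T] f -> (forall t, 0 <= f t <= M) ->
  (\int[P]_(t in D) (f t)%:E)%E \is a fin_num.
Proof.
move=> mD mf f0M; apply: integrable_fin_num => //.
exact: (@bounded_integrable _ _ _ _ _ _ M).
Qed.

Lemma wasserstein1_ge0 (R : realType) (p q : set R -> \bar R) :
  (0 <= wasserstein1 p q)%E.
Proof. by apply: le_ereal_inf_tmp => _ [gam _ <-]; exact: integral_ge0. Qed.

(** For every coupling, the difference of the two integrals of [g] is the integral of [g x - g y]
    against the coupling, hence at most the transport cost. Since [p] and [q] are bare set
    functions, the integrals are taken against measures [mp] and [mq] that represent them on
    measurable sets. Boundedness of [g] gives the integrability needed to subtract. *)
Lemma wasserstein1_ge_lipschitz (R : realType) (p q : set R -> \bar R)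
  (mp mq : {measure set R -> \bar R}) (g : R -> R) (M : R) :
  (forall A, measurable A -> p A = mp A) -> (forall A, measurable A -> q A = mq A) ->
  measurable_fun [set: R] g -> (forall x, 0 <= g x <= M) ->
  (forall x y, `|g x - g y| <= `|x - y|) ->
  (`|\int[mp]_x (g x)%:E - \int[mq]_x (g x)%:E| <= wasserstein1 p q)%E.
Proof.
move=> pE qE mg g0M lipg; apply: le_ereal_inf_tmp => _ [gam gamE <-].
have marg (m : {measure set R -> \bar R}) (pr : R * R -> R) :
    measurable_fun [set: R * R] pr ->
    (forall A, measurable A -> m A = gam (pr @^-1` A)) ->
    (\int[m]_x (g x)%:E = \int[gam]_xy (g (pr xy))%:E)%E.
  move=> mpr mE; rewrite -[RHS]mul1e.
  apply: (@ge0_integral_transfer _ _ _ _ _ _ _ m gam setT setT id pr 1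
    (fun x => (g x)%:E)) => //.
  - by move=> C mC; rewrite mul1e !setTI mE.
  - exact/measurable_EFinP.
  - by move=> x; rewrite lee_fin; have /andP[] := g0M x.
rewrite (marg mp fst)//; last by move=> A mA; rewrite -pE// (gamE A mA).1.
rewrite (marg mq snd)//; last by move=> A mA; rewrite -qE// (gamE A mA).2.
have intg (pr : R * R -> R) : measurable_fun [set: R * R] pr ->
    gam.-integrable setT (EFin \o (g \o pr)).
  move=> mpr; apply: (@bounded_integrable _ _ _ _ _ _ M) => //; last by move=> t; exact: g0M.
  exact: measurableT_comp mg mpr.
rewrite -integralB_EFin//; [|exact: intg..].
have mB : measurable_fun [set: R * R] (fun xy => (g xy.1)%:E - (g xy.2)%:E)%E.
  by under eq_fun do rewrite -EFinB; apply/measurable_EFinP;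
    exact: measurable_funB (measurableT_comp mg measurable_fst)
      (measurableT_comp mg measurable_snd).
apply: le_trans (le_abse_integral _ _ _) _ => //.
apply: ge0_le_integral => //.
- exact: measurableT_comp.
- apply/measurable_EFinP; apply: measurableT_comp => //; exact: measurable_funB.
- by move=> xy _; rewrite -EFinB abse_EFin lee_fin; exact: lipg.
Qed.

(** The shift by 1 cancels here; it serves to bring the clamp into [0, 2], as the duality bound
    takes a nonnegative test function. *)
Lemma clamp_lipschitz (R : realType) (x y : R) :
  `|(Num.min (Num.max x (-1)) 1 + 1) - (Num.min (Num.max y (-1)) 1 + 1)| <= `|x - y|.
Proof.
have h1 : x - y <= `|x - y| by exact: ler_norm.
have h2 : y - x <= `|x - y| by rewrite distrC; exact: ler_norm.
have h3 : 0 <= `|x - y| by [].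
(* With the distance replaced by a number [e] satisfying these three bounds, each branch of the
   clamps is a linear problem. *)
move: (`|x - y|) h1 h2 h3 => e h1 h2 h3.
rewrite ler_norml.
rewrite !maxEle !minEle.
by apply/andP; split; do !case: ifPn; rewrite -?ltNge => *; lra.
Qed.

Lemma integral_comp_bool (R : realType) (d : measure_display) (O : measurableType d)
  (P : {measure set O -> \bar R}) (V : O -> bool) (phi : bool -> \bar R) :
  measurable_fun [set: O] V -> (forall b, 0 <= phi b)%E ->
  (\int[P]_w phi (V w) = \sum_b phi b * P (V @^-1` [set b]))%E.
Proof.
move=> mV phi0.
have mVb b : measurable (V @^-1` [set b]).
  by rewrite -[X in measurable X]setTI; exact: mV.
have -> : [set: O] = V @^-1` [set true] `|` V @^-1` [set false].
  by apply/seteqP; split => w //= _; case: (V w); [left|right].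
rewrite ge0_integral_setU//; last 2 first.
- by apply: measurable_funTS; apply: (measurableT_comp (f := phi)).
- rewrite disj_set2E; apply/eqP/seteqP; split => w //= [] -> //.
rewrite big_bool/=; congr (_ + _)%E.
all: rewrite -integral_cst//; apply: eq_integral => w; rewrite inE/= => -> //.
Qed.

(** On the event [V = b], the entry of index [b] is the training loss, with conditional mean [t],
    and the other one the ghost loss, with conditional mean [a]. The hypotheses carry the factor 1/2
    because they integrate over that event without normalizing. *)
Lemma wasserstein1_cond_law_ge (R : realType) (d : measure_display)
  (O : measurableType d) (P : probability O R) (L0 L1 X : O -> R) (V : O -> bool)
  (a t : R) :
  measurable_fun [set: O] L0 -> measurable_fun [set: O] L1 ->
  measurable_fun [set: O] V -> (forall w, X w = L1 w - L0 w) ->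
  (forall w, 0 <= L0 w <= 1) -> (forall w, 0 <= L1 w <= 1) ->
  (forall b, P (V @^-1` [set b]) = (2^-1)%:E) ->
  (forall b, \int[P]_(w in V @^-1` [set b]) (if b then L1 w else L0 w)%:E
             = (2^-1)%:E * t%:E)%E ->
  (forall b, \int[P]_(w in V @^-1` [set b]) (if b then L0 w else L1 w)%:E
             = (2^-1)%:E * a%:E)%E ->
  (`|a - t|%:E <= \int[P]_w wasserstein1 (cond_law P X V (V w)) (law P X))%E.
Proof.
move=> mL0 mL1 mV XE L001 L101 PV tE aE.
have mX : measurable_fun [set: O] X by rewrite (funext XE); exact: measurable_funB.
have mVb b : measurable (V @^-1` [set b]).
  by rewrite -[X in measurable X]setTI; exact: mV.
(* [X] takes values in [-1, 1], where [g] is a translation. *)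
pose g (x : R) : R := Num.min (Num.max x (-1)) 1 + 1.
have g02 x : 0 <= g x <= 2.
  by rewrite /g maxEle minEle; apply/andP; split; do !case: ifPn; rewrite -?ltNge => *; lra.
have mg : measurable_fun [set: R] g.
  apply: measurable_funD => //; apply: measurable_minr => //.
  exact: measurable_maxr.
have gX w : g (X w) = L1 w - L0 w + 1.
  have := L001 w; have := L101 w => /andP[? ?] /andP[? ?].
  by rewrite /g XE maxEle minEle; do !case: ifPn; rewrite -?ltNge => *; lra.
have mgX : measurable_fun [set: O] (g \o X) by exact: measurableT_comp.
pose G b := (\int[P]_(w in V @^-1` [set b]) (g (X w))%:E)%E.
(* The identity [g (X w) = L1 w - L0 w + 1] is integrated with [L0] moved to the left, so that all
   terms are nonnegative and additivity holds with no integrability condition. *)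
have GE b : (G b + \int[P]_(w in V @^-1` [set b]) (L0 w)%:E =
    \int[P]_(w in V @^-1` [set b]) (L1 w)%:E + (2^-1)%:E)%E.
  have -> : (2^-1)%:E = (\int[P]_(w in V @^-1` [set b]) 1%:E)%E.
    by rewrite integral_cst// mul1e; exact/esym/PV.
  rewrite /G -!ge0_integralD//.
  - by apply: eq_integral => w _; rewrite gX -!EFinD; congr EFin; ring.
  - by move=> w _; rewrite lee_fin; have /andP[] := L101 w.
  - by apply: measurable_funTS; exact/measurable_EFinP.
  - by move=> w _; rewrite lee_fin; have /andP[] := g02 (X w).
  - by apply: measurable_funTS; exact/measurable_EFinP.
  - by move=> w _; rewrite lee_fin; have /andP[] := L001 w.
  - by apply: measurable_funTS; exact/measurable_EFinP.
have G1 : G true = (2^-1 * (t - a + 1))%:E.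
  have := GE true; rewrite (tE true) (aE true) -!EFinM -EFinD => /adde_fin_eq ->.
  by congr EFin; lra.
have G0 : G false = (2^-1 * (a - t + 1))%:E.
  have := GE false; rewrite (tE false) (aE false) -!EFinM -EFinD => /adde_fin_eq ->.
  by congr EFin; lra.
pose m := fine (\int[P]_w (g (X w))%:E)%E.
have mE : (\int[P]_w (g (X w))%:E = m%:E)%E.
  rewrite fineK//; exact: (@bounded_integral_fin_num _ _ _ _ _ _ 2).
have two0 : (0 : R) <= 2 by [].
have Wge b (s : R) : G b = (2^-1 * s)%:E ->
    (`|s - m|%:E <= wasserstein1 (cond_law P X V b) (law P X))%E.
  move=> Gb.
  (* The factor 2 is the inverse of the probability of [V = b], so [mp] is the conditional law as a
     measure. *)
  pose mp : {measure set R -> \bar R} :=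
    mscale (NngNum two0) (pushforward (mrestr P (mVb b)) X).
  pose mq : {measure set R -> \bar R} := pushforward P X.
  have := @wasserstein1_ge_lipschitz _ (cond_law P X V b) (law P X) (mp mX) (mq mX) g 2.
  have -> : (\int[mp mX]_x (g x)%:E = s%:E)%E.
    rewrite ge0_integral_mscale//; last 2 first.
    - exact/measurable_EFinP.
    - by move=> x _; rewrite lee_fin; have /andP[] := g02 x.
    rewrite ge0_integral_pushforward//; last 2 first.
    - exact/measurable_EFinP.
    - by move=> x _; rewrite lee_fin; have /andP[] := g02 x.
    rewrite preimage_setT integral_mrestr//; last 2 first.
    - exact/measurable_EFinP.
    - by move=> x; rewrite lee_fin; have /andP[] := g02 (X x).
    by rewrite [X in (_ * X)%E]Gb -EFinM/=; congr EFin; lra.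
  have -> : (\int[mq mX]_x (g x)%:E = m%:E)%E.
    rewrite ge0_integral_pushforward//; last 2 first.
    - exact/measurable_EFinP.
    - by move=> x _; rewrite lee_fin; have /andP[] := g02 x.
  rewrite -EFinB abse_EFin; apply => //.
  - move=> A mA; rewrite /cond_law PV/= invrK /mp/= /mscale/= /pushforward /mrestr.
    by rewrite muleC.
  - exact: clamp_lipschitz.
pose phi b := wasserstein1 (cond_law P X V b) (law P X).
rewrite (@integral_comp_bool _ _ _ _ V phi)//; last by move=> b; exact: wasserstein1_ge0.
rewrite big_bool/= !PV.
(* The unconditional mean [m] need not be computed: the triangle inequality eliminates it, leaving
   half of [2 * (t - a)] in absolute value. *)
apply: (@le_trans _ _ (`|t - a + 1 - m|%:E * (2^-1)%:E + `|a - t + 1 - m|%:E * (2^-1)%:E)%E).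
  rewrite -!EFinM -EFinD lee_fin -mulrDl ler_pdivlMr//.
  rewrite -[X in _ <= _ + X]normrN.
  apply: le_trans (ler_normD _ _); rewrite distrC.
  rewrite (_ : t - a + 1 - m - _ = (t - a) * 2); last by ring.
  by rewrite normrM (ger0_norm two0).
by apply: leeD; apply: lee_wpmul2r => //; exact: Wge.
Qed.

(** * Joint law of the selected sample and the ghost points *)

Lemma probability_partition_ffun (R : realType) (d : measure_display)
  (O : measurableType d) (P : probability O R) (n : nat) (U : 'I_n -> O -> bool)
  (E : set O) :
  (forall i, measurable_fun [set: O] (U i)) -> measurable E ->
  P E = (\sum_(u : {ffun 'I_n -> bool}) P (E `&` [set w | forall i, U i w = u i]))%E.
Proof.
move=> mU mE.
have mF (u : {ffun 'I_n -> bool}) : measurable [set w | forall i, U i w = u i].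
  rewrite (_ : [set w | _] = \big[setI/setT]_i (U i @^-1` [set u i])).
    apply: bigsetI_measurable => i _; rewrite -[X in measurable X]setTI.
    exact: mU.
  rewrite -bigcap_seq; apply/seteqP; split => t /=.
    by move=> Ht i _; exact: Ht.
  by move=> Ht i; apply: Ht => //=; rewrite mem_index_enum.
have {1}-> : E = \bigcup_(u in [set: {ffun 'I_n -> bool}])
    (E `&` [set w | forall i, U i w = u i]).
  rewrite -setI_bigcupr; apply/esym/setIidPl => w _ /=.
  by exists [ffun i => U i w] => // i; rewrite ffunE.
rewrite measure_fin_bigcup//; first last.
- by move=> u _; exact: measurableI.
- apply/trivIsetP => u v _ _ uv; apply/seteqP; split => // w [[_ uw] [_ vw]].
  by move/eqP: uv; apply; apply/ffunP => i; rewrite -uw -vw.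
- exact: finite_finset.
- rewrite [RHS]fsbig_seq ?index_enum_uniq//; congr (\big[_/_]_(_ \in _) _).
  by apply/seteqP; split => u //= _; rewrite mem_index_enum.
Qed.

Lemma measurable_select (dO dZ : measure_display)
  (O : measurableType dO) (Z : measurableType dZ) (n : nat)
  (Zt : 'I_n -> bool -> O -> Z) (U : 'I_n -> O -> bool) :
  (forall i j, measurable_fun [set: O] (Zt i j)) ->
  (forall i, measurable_fun [set: O] (U i)) ->
  measurable_fun [set: O] (select_sample Zt U).
Proof.
move=> mZt mU; apply/measurable_fun_tnthP => k.
rewrite (_ : _ \o _ = fun w => if U k w then Zt k true w else Zt k false w).
  exact: measurable_fun_ifT.
by apply/funext => w /=; rewrite tnth_mktuple; case: (U k w).
Qed.

Section supersample.
Unset Implicit Arguments.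
Context (R : realType) (dO dZ dW : measure_display)
  (O : measurableType dO) (Z : measurableType dZ) (Wt : measurableType dW)
  (P : probability O R) (mu : probability Z R) (n : nat)
  (Alg : R.-pker (n.-tuple Z) ~> Wt)
  (S : O -> n.-tuple Z) (W0 : O -> Wt)
  (S_meas : measurable_fun [set: O] S)
  (S_indep : mutual_indep P (fun i : 'I_n => preimg (fun w => tnth (S w) i)))
  (S_law : forall (i : 'I_n) (B : set Z), measurable B ->
             P ((fun w => tnth (S w) i) @^-1` B) = mu B)
  (W0_alg : forall (C : set (n.-tuple Z)) (B : set Wt),
      measurable C -> measurable B ->
      P (S @^-1` C `&` W0 @^-1` B) = (\int[P]_(w in S @^-1` C) Alg (S w) B)%E)
  (Zt : 'I_n -> bool -> O -> Z) (U : 'I_n -> O -> bool) (W : O -> Wt)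
  (Zt_meas : forall i j, measurable_fun [set: O] (Zt i j))
  (U_meas : forall i, measurable_fun [set: O] (U i))
  (Zt_law : forall i j (B : set Z), measurable B -> P (Zt i j @^-1` B) = mu B)
  (U_law : forall i (b : bool), P (U i @^-1` [set b]) = (2^-1)%:E)
  (ZtU_indep : mutual_indep P (supersample_family Zt U))
  (W_alg : forall (C : set (n.-tuple (Z * Z * bool)%type)) (B : set Wt),
      measurable C -> measurable B ->
      P (supersample_data Zt U @^-1` C `&` W @^-1` B) =
      (\int[P]_(w in supersample_data Zt U @^-1` C)
          Alg (select_sample Zt U w) B)%E).
Set Implicit Arguments.

(** Once the selectors are fixed to [u], the indices of the training and ghost points are no longer
    random, and the event is an intersection of one event per member of the independent family. *)
Lemma supersample_boxE (u : 'I_n -> bool) (A D : 'I_n -> set Z) (B : 'I_n -> set bool) :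
  (forall k, measurable (A k)) -> (forall k, measurable (D k)) ->
  P [set w | forall k, [/\ U k w = u k, B k (u k), A k (Zt k (u k) w)
                       & D k (Zt k (~~ u k) w)]] =
  (\prod_k (2^-1 * (u k \in B k)%:R * fine (mu (A k)) * fine (mu (D k))))%:E.
Proof.
move=> mA mD.
pose F (q : 'I_n * option bool) : set O :=
  match q.2 with
  | None => U q.1 @^-1` ([set u q.1] `&` B q.1)
  | Some j => Zt q.1 j @^-1` (if j == u q.1 then A q.1 else D q.1)
  end.
have := ZtU_indep F.
rewrite (_ : \bigcap_(i in _) F i = [set w | forall k,
    [/\ U k w = u k, B k (u k), A k (Zt k (u k) w) & D k (Zt k (~~ u k) w)]]); last first.
  apply/seteqP; split => w /=.
    move=> Fw k; have [/= UkE Bk] := Fw (k, None) I.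
    have /= := Fw (k, Some (u k)) I; rewrite /F/= eqxx => Akw.
    have /= := Fw (k, Some (~~ u k)) I; rewrite /F/= (negbTE (_ : ~~ u k != u k)); last by case: (u k).
    by split => //; rewrite -UkE.
  move=> H [k [j|]] _ /=; have [Uk Bk Ak Dk] := H k.
    rewrite /F/=; case: eqP => [->//|/eqP ju].
    by rewrite (_ : j = ~~ u k)//; move: ju; case: (j) (u k) => [] [].
  by split => //=; rewrite Uk.
move=> ->; last first.
  move=> [k [j|]]; rewrite /supersample_family /F/=.
    by exists (if j == u k then A k else D k) => //; case: ifP.
  by exists ([set u k] `&` B k).
congr EFin.
rewrite -(pair_bigA _ (fun k o => fine (P (F (k, o)))))/=.
apply: eq_bigr => k _.
(* The three members of the family at [k] are the selector, the training point and the ghost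
   point. *)
have -> (G : option bool -> R) : \prod_o G o = G None * G (Some (u k)) * G (Some (~~ u k)).
  rewrite (bigD1 None)//= (bigD1 (Some (u k)))//= (bigD1 (Some (~~ u k)))//=; last first.
    by apply/eqP => -[]; case: (u k).
  rewrite big1 ?mulr1 ?mulrA// => -[j|]//=.
  by case: j (u k) => [] [].
rewrite /F/= eqxx (negbTE (_ : ~~ u k != u k)); last by case: (u k).
rewrite !Zt_law//; congr (_ * _ * _).
(* The selector event has probability 1/2 or is empty, according to whether [u k] lies in [B k]. *)
case: (boolP (u k \in B k)) => uB.
  rewrite mulr1 (_ : [set u k] `&` B k = [set u k]) ?U_law//.
  by apply/seteqP; split => x /=; [case|move=> ->; split => //; rewrite inE in uB].
rewrite mulr0 (_ : [set u k] `&` B k = set0) ?preimage_set0 ?measure0//.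
apply/seteqP; split => x //= -[-> Bu]; move/negP: uB; apply; exact: mem_set.
Qed.

(** Sum [supersample_boxE] over all selector vectors. Its right-hand side is a product over [k] of
    terms that depend on [u k] alone, so distributivity turns the sum of products into a product of
    sums. *)
Lemma supersample_factor (A D : 'I_n -> set Z) (B : 'I_n -> set bool) :
  (forall k, measurable (A k)) -> (forall k, measurable (D k)) ->
  P [set w | forall k, [/\ B k (U k w), A k (Zt k (U k w) w)
                       & D k (Zt k (~~ U k w) w)]] =
  (\prod_k ((\sum_b 2^-1 * (b \in B k)%:R) * fine (mu (A k)) * fine (mu (D k))))%:E.
Proof.
move=> mA mD.
set E := [set w | _].
have mE : measurable E.
  rewrite (_ : E = \big[setI/setT]_k (U k @^-1` B k `&`
    ((fun w => if U k w then Zt k true w else Zt k false w) @^-1` A k `&`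
     (fun w => if U k w then Zt k false w else Zt k true w) @^-1` D k))).
    apply: bigsetI_measurable => i _; apply: measurableI; [|apply: measurableI];
      rewrite -[X in measurable X]setTI.
    - exact: U_meas.
    - exact: measurable_fun_ifT.
    - exact: measurable_fun_ifT.
  rewrite -bigcap_seq; apply/seteqP; split => w /=.
    by move=> + k _ => /(_ k)/=; case: (U k w) => -[].
  move=> + k => /(_ k (mem_index_enum k)).
  by rewrite /=; case: (U k w) => -[? []].
rewrite (probability_partition_ffun _ U_meas mE).
transitivity (\sum_(u : {ffun 'I_n -> bool}) (\prod_k (2^-1 * (u k \in B k)%:R *
    fine (mu (A k)) * fine (mu (D k))))%:E)%E.
  apply: eq_bigr => u _.
  rewrite (_ : E `&` _ = [set w | forall k,
      [/\ U k w = u k, B k (u k), A k (Zt k (u k) w) & D k (Zt k (~~ u k) w)]]); last first.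
    apply/seteqP; split => w /=.
      by move=> [Ew Uw] k; rewrite -Uw; have [] := Ew k.
    by move=> H; split => k; have [Uk] := H k; rewrite ?Uk.
  exact: supersample_boxE.
rewrite sumEFin; congr EFin.
rewrite -(bigA_distr_bigA (fun k (b : bool) =>
  2^-1 * (b \in B k)%:R * fine (mu (A k)) * fine (mu (D k)))).
by apply: eq_bigr => k _; rewrite -!mulr_suml.
Qed.

(* Given [U i = b], the selected sample is distributed as [S] and is independent
   of the ghost point [Zt i (~~ b)]. *)
Lemma supersample_cond (i : 'I_n) (b : bool) (D : set Z) (C : set (n.-tuple Z)) :
  measurable D -> measurable C ->
  (P ((U i @^-1` [set b] `&` Zt i (~~ b) @^-1` D) `&` select_sample Zt U @^-1` C) =
  (2^-1 * fine (mu D))%:E * P (S @^-1` C))%E.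
Proof.
move=> mD mC.
set E := _ `&` _ @^-1` D.
have mE : measurable E.
  by apply: measurableI; rewrite -[X in measurable X]setTI;
    [exact: U_meas|exact: Zt_meas].
have msel := measurable_select Zt_meas U_meas.
have c0 : 0 <= 2^-1 * fine (mu D) by rewrite mulr_ge0// fine_ge0.
rewrite -[2^-1 * _]/(NngNum c0)%:num.
pose m : {measure set (n.-tuple Z) -> \bar R} :=
  pushforward (mrestr P mE) (select_sample Zt U).
pose m' : {measure set (n.-tuple Z) -> \bar R} :=
  mscale (NngNum c0) (pushforward P S).
have : m msel C = m' S_meas C; last by rewrite /m /m'/= /mscale /pushforward /mrestr/= setIC.
apply: finite_measure_tuple_unique mC => [|A mA].
  rewrite /m/= /pushforward /mrestr; apply: (@le_lt_trans _ _ 1%E); last exact: ltry.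
  by apply: probability_le1; rewrite preimage_setT setTI.
rewrite /m /m'/= /mscale/= /pushforward /mrestr/=.
have -> : P (S @^-1` box A) = (\prod_k fine (mu (A k)))%:E.
  rewrite (_ : S @^-1` box A =
      \bigcap_(k in [set: 'I_n]) (fun w => tnth (S w) k) @^-1` A k).
    rewrite S_indep => [|k]; last by exists (A k).
    by congr EFin; apply: eq_bigr => k _; rewrite S_law.
  by apply/seteqP; split => w /= H k; [move=> _|]; apply: H.
(* The selector and the ghost point are constrained at the coordinate [i] only. *)
pose B' k : set bool := if k == i then [set b] else setT.
pose D' k := if k == i then D else setT.
rewrite (_ : _ `&` E = [set w | forall k, [/\ B' k (U k w), A k (Zt k (U k w) w)
                       & D' k (Zt k (~~ U k w) w)]]); last first.
  apply/seteqP; split => w /=; rewrite /B' /D'.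
    move=> [Aw [/= Ui Di]] k; have := Aw k; rewrite tnth_mktuple => Ak; split => //.
      by case: eqP => // ->.
    by case: eqP => // ->; rewrite Ui.
  move=> H; split.
    by move=> k; rewrite tnth_mktuple; have [] := H k.
  by have [] := H i; rewrite eqxx => /= Ui _ Di; split => //=; rewrite -Ui.
rewrite supersample_factor//; last first.
  by move=> k; rewrite /D'; case: ifP.
rewrite -EFinM; congr EFin.
(* The coordinate [i] yields 1/2 and the mass of [D] besides that of [A i]; at any other coordinate
   the two halves add up to 1 and only the mass of [A k] remains. *)
rewrite (bigD1 i)//= [in RHS](bigD1 i)//=.
rewrite {1}/B' {1}/D' eqxx.
have -> : \sum_(b0 : bool) 2^-1 * (b0 \in [set b])%:R = 2^-1 :> R.
  have in1 (x : bool) : (x \in [set b]) = (x == b) by apply/idP/eqP; rewrite inE.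
  by rewrite big_bool/= !in1; case: (b); rewrite !(mulr1, mulr0, addr0, add0r).
rewrite [X in _ * X = _](_ : _ = \prod_(k < n | k != i) fine (mu (A k))).
  by ring.
apply: eq_bigr => k ki; rewrite /B' /D' (negbTE ki).
rewrite big_bool/= !in_setT probability_setT/=; lra.
Qed.

(** * Joint law of the hypothesis and one data point given the selector *)

(** The conditioning event is determined by the supersample and the selectors, so it is the preimage
    of a measurable set [C] of data and [W_alg] applies. *)
Lemma supersample_hyp_prob (i : 'I_n) (b j : bool) (D : set Z) (B : set Wt) :
  measurable D -> measurable B ->
  P ((U i @^-1` [set b] `&` Zt i j @^-1` D) `&` W @^-1` B) =
  (\int[P]_(w in U i @^-1` [set b] `&` Zt i j @^-1` D)
      Alg (select_sample Zt U w) B)%E.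
Proof.
move=> mD mB.
pose C : set (n.-tuple (Z * Z * bool)%type) :=
  (fun v => (tnth v i).2) @^-1` [set b] `&`
  (fun v => if j then (tnth v i).1.2 else (tnth v i).1.1) @^-1` D.
have mC : measurable C.
  have mt : measurable_fun [set: n.-tuple (Z * Z * bool)%type] (fun v => tnth v i).
    exact: measurable_tnth.
  have mt1 : measurable_fun [set: n.-tuple (Z * Z * bool)%type] (fun v => (tnth v i).1).
    exact: (measurableT_comp measurable_fst mt).
  apply: measurableI; rewrite -[X in measurable X]setTI.
    by apply: (measurableT_comp measurable_snd mt).
  case: (j).
    by apply: (measurableT_comp measurable_snd mt1).
  by apply: (measurableT_comp measurable_fst mt1).
have -> : U i @^-1` [set b] `&` Zt i j @^-1` D = supersample_data Zt U @^-1` C.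
  by apply/seteqP; split => w /=; rewrite /C/= tnth_mktuple/=; case: (j).
exact: W_alg.
Qed.

(** Given [U i = b], the point [Zt i b] is the coordinate [i] of the selected sample. Both
    probabilities are then integrals of the same function [Alg s B] of the sample, whose law given
    [U i = b] is that of [S]. *)
Lemma train_law (i : 'I_n) (b : bool) (B : set Wt) (D : set Z) :
  measurable B -> measurable D ->
  (P (U i @^-1` [set b] `&` (fun w => (W w, Zt i b w)) @^-1` (B `*` D)) =
   (2^-1)%:E * P ((fun w => (W0 w, tnth (S w) i)) @^-1` (B `*` D)))%E.
Proof.
move=> mB mD.
pose C := (fun t : n.-tuple Z => tnth t i) @^-1` D.
have mC : measurable C by rewrite -[X in measurable X]setTI; exact: measurable_tnth.
have -> : (fun w => (W0 w, tnth (S w) i)) @^-1` (B `*` D) =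
    S @^-1` C `&` W0 @^-1` B by apply/seteqP; split => w /= [].
have -> : U i @^-1` [set b] `&` (fun w => (W w, Zt i b w)) @^-1` (B `*` D) =
    (U i @^-1` [set b] `&` Zt i b @^-1` D) `&` W @^-1` B.
  by apply/seteqP; split => w /=; tauto.
rewrite W0_alg// supersample_hyp_prob//.
have mpre dT (T : measurableType dT) (f : O -> T) A :
    measurable_fun [set: O] f -> measurable A -> measurable (f @^-1` A).
  by move=> mf mA; rewrite -[X in measurable X]setTI; exact: mf.
apply: (ge0_integral_transfer (f := fun s => Alg s B)) => //.
- by apply: measurableI; exact: mpre.
- exact: mpre.
- exact: measurable_select.
- move=> A mA.
  (* The ghost point is left free; the constraint on the training point is part of the event [C] on
     the sample. *)
  have := supersample_cond i b measurableT (measurableI _ _ mC mA).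
  rewrite probability_setT/= mulr1 => <-; congr (P _).
  apply/seteqP; split => w /=; rewrite /C/= tnth_mktuple.
    by move=> [[-> ?] ?].
  by move=> [[Ub _] [+ ?]]; rewrite Ub.
- exact: measurable_kernel.
Qed.

(** Given [U i = b], the ghost point is independent of the selected sample, and the hypothesis is
    drawn from that sample alone. The ghost constraint thus only contributes the constant [mu D] to
    the transfer factor. *)
Lemma test_law (i : 'I_n) (b : bool) (B : set Wt) (D : set Z) :
  measurable B -> measurable D ->
  (P (U i @^-1` [set b] `&` (fun w => (W w, Zt i (~~ b) w)) @^-1` (B `*` D)) =
   (2^-1)%:E * (P (W0 @^-1` B) * mu D))%E.
Proof.
move=> mB mD.
have -> : U i @^-1` [set b] `&` (fun w => (W w, Zt i (~~ b) w)) @^-1` (B `*` D) =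
    (U i @^-1` [set b] `&` Zt i (~~ b) @^-1` D) `&` W @^-1` B.
  by apply/seteqP; split => w /=; tauto.
have := W0_alg _ _ measurableT mB; rewrite preimage_setT setTI => ->.
rewrite supersample_hyp_prob//.
have mpre dT (T : measurableType dT) (f : O -> T) A :
    measurable_fun [set: O] f -> measurable A -> measurable (f @^-1` A).
  by move=> mf mA; rewrite -[X in measurable X]setTI; exact: mf.
rewrite [X in (_ * X)%E]muleC muleA -[X in (_ * X * _)%E]fineK; last first.
  by rewrite fin_num_measure.
rewrite -EFinM.
apply: (ge0_integral_transfer (f := fun s => Alg s B)) => //.
- by apply: measurableI; exact: mpre.
- exact: measurable_select.
- by rewrite mulr_ge0// fine_ge0.
- by move=> A mA; rewrite setTI; exact: supersample_cond.
- exact: measurable_kernel.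
Qed.

End supersample.

(** * From the conditional laws to the generalization error *)

Unset Implicit Arguments.
Set Strict Implicit.

Theorem theorem5 (R : realType)
  (dX dY dW dO : measure_display)
  (X : measurableType dX) (Y : measurableType dY)
  (Wt : measurableType dW) (O : measurableType dO)
  (P : probability O R) (mu : probability (X * Y)%type R)
  (n : nat) (n_gt0 : (0 < n)%N)
  (* loss with values in [0,1] *)
  (loss : Wt -> (X * Y)%type -> R)
  (loss_meas : measurable_fun [set: (Wt * (X * Y))%type]
                 (fun p => loss p.1 p.2))
  (loss01 : forall w z, 0 <= loss w z <= 1)
  (* the (randomized) learning algorithm, as the Markov kernel P_{W|S} *)
  (Alg : R.-pker (n.-tuple (X * Y)%type) ~> Wt)
  (* original setting: S ~ mu^n, W0 ~ P_{W|S} *)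
  (S : O -> n.-tuple (X * Y)%type) (W0 : O -> Wt)
  (S_meas : measurable_fun [set: O] S) (W0_meas : measurable_fun [set: O] W0)
  (S_indep : mutual_indep P (fun i : 'I_n => preimg (fun w => tnth (S w) i)))
  (S_law : forall (i : 'I_n) (B : set (X * Y)%type), measurable B ->
             P ((fun w => tnth (S w) i) @^-1` B) = mu B)
  (W0_alg : forall (C : set (n.-tuple (X * Y)%type)) (B : set Wt),
      measurable C -> measurable B ->
      P (S @^-1` C `&` W0 @^-1` B) = (\int[P]_(w in S @^-1` C) Alg (S w) B)%E)
  (* supersample setting *)
  (Zt : 'I_n -> bool -> O -> (X * Y)%type) (U : 'I_n -> O -> bool) (W : O -> Wt)
  (Zt_meas : forall i j, measurable_fun [set: O] (Zt i j))
  (U_meas : forall i, measurable_fun [set: O] (U i))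
  (W_meas : measurable_fun [set: O] W)
  (Zt_law : forall i j (B : set (X * Y)%type), measurable B ->
              P (Zt i j @^-1` B) = mu B)
  (U_law : forall i (b : bool), P (U i @^-1` [set b]) = (2^-1)%:E)
  (ZtU_indep : mutual_indep P (supersample_family Zt U))
  (W_alg : forall (C : set (n.-tuple ((X * Y) * (X * Y) * bool)%type)) (B : set Wt),
      measurable C -> measurable B ->
      P (supersample_data Zt U @^-1` C `&` W @^-1` B) =
      (\int[P]_(w in supersample_data Zt U @^-1` C)
          Alg (select_sample Zt U w) B)%E) :
  (`| gen_error P mu loss S W0 | <=
   ((n%:R)^-1)%:E *
   \sum_(i < n) \int[P]_w
       wasserstein1 (cond_law P (DeltaL loss W Zt i) (U i) (U i w))
                    (law P (DeltaL loss W Zt i)))%E.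
Proof.
pose Z := (X * Y)%type.
pose l (q : Wt * Z) : \bar R := (loss q.1 q.2)%:E.
have ml : measurable_fun [set: Wt * Z] l by exact/measurable_EFinP.
have l0 q : (0 <= l q)%E by rewrite lee_fin; have /andP[] := loss01 q.1 q.2.
have mlossWZ (V : O -> Wt) (T : O -> Z) : measurable_fun [set: O] V ->
    measurable_fun [set: O] T -> measurable_fun [set: O] (fun w => loss (V w) (T w)).
  move=> mV mT.
  exact: (measurableT_comp loss_meas (measurable_fun_pair mV mT)).
have mSi i : measurable_fun [set: O] (fun w => tnth (S w) i).
  exact: (measurableT_comp (measurable_tnth i) S_meas).
have mUb i b : measurable (U i @^-1` [set b]).
  by rewrite -[X in measurable X]setTI; exact: U_meas.
pose t i := fine (\int[P]_w (loss (W0 w) (tnth (S w) i))%:E)%E.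
have tE i : (\int[P]_w (loss (W0 w) (tnth (S w) i))%:E = (t i)%:E)%E.
  rewrite fineK//; apply: (@bounded_integral_fin_num _ _ _ _ _ _ 1) => //.
  exact: mlossWZ.
pose a := fine (\int[P]_w \int[mu]_z (loss (W0 w) z)%:E)%E.
have mW0 : measurable_fun [set: O * Z] (fun q => loss (W0 q.1) q.2).
  exact: (measurableT_comp loss_meas
    (measurable_fun_pair (measurableT_comp W0_meas measurable_fst) measurable_snd)).
(* As an integral over [P \x mu], the population risk is the mean loss of a hypothesis and an
   independent point, the form in which [test_law] can be transferred. *)
have fub : (\int[P]_w \int[mu]_z (loss (W0 w) z)%:E =
    \int[P \x mu]_q (loss (W0 q.1) q.2)%:E)%E.
  apply/esym; apply: (@fubini_tonelli1 _ _ _ _ _ P mu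
    (fun q : O * Z => (loss (W0 q.1) q.2)%:E)).
  - exact/measurable_EFinP.
  - by move=> q; rewrite lee_fin; have /andP[] := loss01 (W0 q.1) q.2.
have aE : (\int[P]_w \int[mu]_z (loss (W0 w) z)%:E = a%:E)%E.
  rewrite fineK// fub.
  exact: (@bounded_integral_fin_num _ _ _ (P \x mu)%E _ _ 1).
have half0 : (0 : R) <= 2^-1 by [].
have train i b : (\int[P]_(w in U i @^-1` [set b]) (loss (W w) (Zt i b w))%:E
    = (2^-1)%:E * (t i)%:E)%E.
  rewrite -tE.
  apply: (@ge0_integral_transfer_prod _ _ _ _ _ _ _ _ _ P P (U i @^-1` [set b])
    (fun w => (W w, Zt i b w)) (fun w => (W0 w, tnth (S w) i)) (2^-1) l) => //.
  - exact: measurable_fun_pair.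
  - exact: measurable_fun_pair.
  - move=> B D mB mD.
    exact: (train_law S_meas S_indep S_law W0_alg Zt_meas U_meas Zt_law U_law ZtU_indep W_alg).
have test i b : (\int[P]_(w in U i @^-1` [set b]) (loss (W w) (Zt i (~~ b) w))%:E
    = (2^-1)%:E * a%:E)%E.
  rewrite -aE fub.
  apply: (@ge0_integral_transfer_prod _ _ _ _ _ _ _ _ _ P (P \x mu)%E (U i @^-1` [set b])
    (fun w => (W w, Zt i (~~ b) w)) (fun q => (W0 q.1, q.2)) (2^-1) l) => //.
  - exact: measurable_fun_pair.
  - exact: measurable_fun_pair (measurableT_comp W0_meas measurable_fst) measurable_snd.
  - move=> B D mB mD.
    rewrite (test_law S_meas S_indep S_law W0_alg Zt_meas U_meas Zt_law U_law ZtU_indep W_alg)//.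
    (* The product in [test_law] is the mass of a rectangle under [P \x mu]. *)
    congr (_ * _)%E; apply/esym; apply: product_measure1E => //.
    by rewrite -[X in measurable X]setTI; exact: W0_meas.
have Wge i : (`|a - t i|%:E <= \int[P]_w
    wasserstein1 (cond_law P (DeltaL loss W Zt i) (U i) (U i w))
                 (law P (DeltaL loss W Zt i)))%E.
  apply: (@wasserstein1_cond_law_ge _ _ _ P (fun w => loss (W w) (Zt i false w))
    (fun w => loss (W w) (Zt i true w))) => //.
  - exact: mlossWZ.
  - exact: mlossWZ.
  - by move=> b; rewrite -(train i b); apply: eq_integral => w _; case: b.
  - by move=> b; rewrite -(test i b); apply: eq_integral => w _; case: b.
have n0 : (0 : R) <= n%:R^-1 by rewrite invr_ge0.
have LnE : (\int[P]_w (n%:R^-1 * \sum_(i < n) loss (W0 w) (tnth (S w) i))%:E =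
    (n%:R^-1 * \sum_(i < n) t i)%:E)%E.
  under eq_integral do rewrite EFinM -sumEFin.
  rewrite ge0_integralZl//; last 2 first.
  - by apply: emeasurable_sum => i; apply/measurable_EFinP; exact: mlossWZ.
  - move=> w _; apply: sume_ge0 => i _; rewrite lee_fin.
    by have /andP[] := loss01 (W0 w) (tnth (S w) i).
  rewrite ge0_integral_sum//; last 2 first.
  - by move=> i; apply/measurable_EFinP; exact: mlossWZ.
  - by move=> i w _; rewrite lee_fin; have /andP[] := loss01 (W0 w) (tnth (S w) i).
  by rewrite EFinM -sumEFin; congr (_ * _)%E; apply: eq_bigr => i _; rewrite tE.
rewrite /gen_error aE LnE -EFinB abse_EFin.
apply: (@le_trans _ _ ((n%:R^-1)%:E * \sum_(i < n) `|a - t i|%:E)%E); last first.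
  by apply: lee_wpmul2l => //; apply: lee_sum => i _; exact: Wge.
rewrite sumEFin -EFinM lee_fin.
(* Positivity of [n] enters here: [a] is the average of [n] copies of itself. *)
have -> : a - n%:R^-1 * \sum_(i < n) t i = n%:R^-1 * \sum_(i < n) (a - t i).
  rewrite sumrB sumr_const card_ord mulrBr -[a *+ n]mulr_natl mulKf//.
  by rewrite pnatr_eq0 -lt0n.
by rewrite normrM (ger0_norm n0) ler_wpM2l// ler_norm_sum.
Qed.
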